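(* Let $\lambda$ be a nonzero real parameter and $x$ a variable. For all integers $n,k\ge 0$, \[ \frac{n!}{k!}\sum_{l=0}^{k}\binom{k}{l}(-1)^{k-l}\binom{l+x}{n}_{\lambda}=\begin{cases} S_{2,\lambda}(n,k\mid x), & \text{if } n\ge k,\\ 0, & \text{if } n<k.\end{cases} \]
   Context: For $\lambda\neq 0$, set $(x)_{0,\lambda}=1$, $(x)_{l,\lambda}=x(x-\lambda)(x-2\lambda)\cdots(x-(l-1)\lambda)$ for $l\ge1$, and $\binom{x}{l}_{\lambda}=\frac{(x)_{l,\lambda}}{l!}$, so that $(1+\lambda t)^{x/\lambda}=\sum_{l\ge0}\binom{x}{l}_\lambda t^l$ as formal power series in $t$. The degenerate Stirling polynomials of the second kind $S_{2,\lambda}(n,k\mid x)$ are defined by the generating function \[ \frac{1}{k!}(1+\lambda t)^{x/\lambda}\big((1+\lambda t)^{1/\lambda}-1\big)^k=\sum_{n=k}^{\infty}S_{2,\lambda}(n,k\mid x)\frac{t^n}{n!}. \] *)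

(* Defs.v *)
From HB Require Import structures.
From mathcomp Require Import all_boot all_order all_algebra.
From mathcomp Require Import reals.

Set Implicit Arguments.
Unset Strict Implicit.
Unset Printing Implicit Defensive.

Import GRing.Theory.
Local Open Scope ring_scope.

(* Formal power series in t over A, as coefficient sequences. *)
Definition fps (A : Type) := nat -> A.

Definition fps_one (A : comNzRingType) : fps A := fun n => (n == 0%N)%:R.

Definition fps_sub (A : comNzRingType) (f g : fps A) : fps A :=
  fun n => f n - g n.

Definition fps_mul (A : comNzRingType) (f g : fps A) : fps A :=
  fun n => \sum_(i < n.+1) f i * g (n - i)%N.

Definition fps_exp (A : comNzRingType) (f : fps A) (k : nat) : fps A :=
  iter k (fps_mul f) (fps_one A).

Definition fps_scale (R : nzRingType) (V : lmodType R) (c : R) (f : fps V) :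
    fps V :=
  fun n => c *: f n.

(* (1 + lam t)^a for a polynomial exponent a: the binomial series
   sum_l a (a - 1) ... (a - l + 1) / l! (lam t)^l. *)
Definition fps_binomial (R : realType) (lam : R) (a : {poly R}) :
    fps {poly R} :=
  fun l => (lam ^+ l / l`!%:R) *: \prod_(i < l) (a - i%:R).

Definition deg_ffact (R : realType) (lam : R) (p : {poly R}) (l : nat) :
    {poly R} :=
  \prod_(i < l) (p - (i%:R * lam)%:P).

Definition deg_binom (R : realType) (lam : R) (p : {poly R}) (l : nat) :
    {poly R} :=
  (l`!%:R)^-1 *: deg_ffact lam p l.

(* (1/k!) (1 + lam t)^(x/lam) ((1 + lam t)^(1/lam) - 1)^k, the variable x
   being 'X. *)
Definition deg_stirling2_gf (R : realType) (lam : R) (k : nat) :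
    fps {poly R} :=
  fps_scale (k`!%:R)^-1
    (fps_mul (fps_binomial lam (lam^-1 *: 'X))
       (fps_exp (fps_sub (fps_binomial lam (lam^-1)%:P) (fps_one {poly R})) k)).

(* S_{2,lam}(n, k | x) as a polynomial in x = 'X: the coefficient of t^n / n!
   in the generating function. *)
Definition deg_stirling2 (R : realType) (lam : R) (n k : nat) : {poly R} :=
  n`!%:R *: deg_stirling2_gf lam k n.

(* Main.v *)
Require Import Defs.
From HB Require Import structures.
From mathcomp Require Import all_boot all_order all_algebra.
From mathcomp Require Import boolp reals.
From mathcomp Require Import ring.
Import GRing.Theory Num.Theory.
Local Open Scope ring_scope.

(** Write [B p] for the series (1 + lam t)^(p / lam). Vandermonde's identity
    [B p * B q = B (p + q)] shows that [B p * (B 1 - 1)^k] and the k-th forward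
    difference of [p |-> B p] obey the same recurrence
    [F (k + 1) p = F k (p + 1) - F k p], so they coincide. The case n < k holds
    because [B 1 - 1] has no constant term. *)

Section FormalPowerSeries.
Variable A : comNzRingType.
Implicit Types f g h : fps A.

(** A product coefficient of index n involves only coefficients of index at most n, so truncation is
    harmless and associativity can be inherited from polynomials. *)
Lemma fps_mul_poly f g m n : (n < m)%N ->
  fps_mul f g n = ((\poly_(i < m) f i) * (\poly_(i < m) g i))`_n.
Proof.
move=> lt_nm; rewrite coefM; apply: eq_bigr => i _.
have le_in : (i <= n)%N by rewrite -ltnS.
by rewrite !coef_poly (leq_ltn_trans le_in) // (leq_ltn_trans (leq_subr i n)).
Qed.

Lemma fps_mulA f g h :
  fps_mul f (fps_mul g h) = fps_mul (fps_mul f g) h.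
Proof.
apply/funext => n.
pose P (u : fps A) := \poly_(i < n.+1) u i.
transitivity ((P f * (P g * P h))`_n).
  rewrite coefM; apply: eq_bigr => i _.
  rewrite coef_poly ltn_ord (fps_mul_poly _ _ n.+1) //.
  by rewrite ltnS leq_subr.
rewrite mulrA coefM; apply: eq_bigr => i _.
by rewrite (fps_mul_poly _ _ n.+1) // coef_poly ltnS leq_subr.
Qed.

Lemma fps_mul1 f : fps_mul f (fps_one A) = f.
Proof.
apply/funext => n; rewrite /fps_mul big_ord_recr /= subnn mulr1 big1 ?add0r //.
by move=> i _; rewrite /fps_one subn_eq0 leqNgt ltn_ord mulr0.
Qed.

Lemma fps_mulBl f g h :
  fps_mul (fps_sub f g) h = fps_sub (fps_mul f h) (fps_mul g h).
Proof.
by apply/funext => n; rewrite /fps_sub -sumrB; apply: eq_bigr => i _;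
  rewrite mulrBl.
Qed.

Lemma fps_mulBr f g h :
  fps_mul f (fps_sub g h) = fps_sub (fps_mul f g) (fps_mul f h).
Proof.
by apply/funext => n; rewrite /fps_sub -sumrB; apply: eq_bigr => i _;
  rewrite mulrBr.
Qed.

(** Orders in t add up: if [i >= a], then [n < a + b] forces [n - i < b], so each term has a zero
    factor. *)
Lemma fps_mul_vanish f g a b :
    (forall i, (i < a)%N -> f i = 0) -> (forall j, (j < b)%N -> g j = 0) ->
  forall n, (n < a + b)%N -> fps_mul f g n = 0.
Proof.
move=> f0 g0 n lt_n; apply: big1 => i _.
have [/f0 -> | le_ai] := ltnP i a; first by rewrite mul0r.
have le_in : (i <= n)%N by rewrite -ltnS.
rewrite g0 ?mulr0 // ltn_subLR //.
by apply: leq_trans lt_n _; rewrite leq_add2r.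
Qed.

Lemma fps_exp_vanish f k n : f 0%N = 0 -> (n < k)%N -> fps_exp f k n = 0.
Proof.
move=> f0; elim: k n => [//|k IHk] n lt_nk.
by apply: (fps_mul_vanish _ _ 1 k) => // -[].
Qed.

End FormalPowerSeries.

Arguments fps_mul_vanish {A f g} a b.


(** Pascal's rule splits every term except l = 0, which rejoins the unshifted sum. *)
Lemma binomial_differenceS (A : comPzRingType) (F : nat -> A) (k : nat) :
  \sum_(l < k.+2) 'C(k.+1, l)%:R * (-1) ^+ (k.+1 - l) * F l =
  \sum_(l < k.+1) 'C(k, l)%:R * (-1) ^+ (k - l) * F l.+1 -
  \sum_(l < k.+1) 'C(k, l)%:R * (-1) ^+ (k - l) * F l.
Proof.
rewrite big_ord_recl /=.
under eq_bigr => i _ do rewrite /bump /= add1n binS natrD subSS 2!mulrDl.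
rewrite big_split /= addrA addrC; congr (_ + _).
(* The top term carries ['C(k, k.+1) = 0]; the others differ from the target by one sign. *)
rewrite big_ord_recr /= (@bin_small k k.+1) // !mul0r addr0.
rewrite [in RHS]big_ord_recl opprD -sumrN !bin0 !subn0 exprS !mul1r mulN1r mulNr.
congr (_ + _); apply: eq_bigr => i _.
by rewrite lift0 -(subnSK (ltn_ord i)) exprS mulN1r mulrN mulNr.
Qed.

Section DegenerateBinomial.
Variables (R : realType) (lam : R).
Implicit Types p q : {poly R}.
Local Notation B := (deg_binom lam).

Lemma deg_binom0 p : B p 0%N = 1.
Proof. by rewrite /deg_binom /deg_ffact big_ord0 fact0 invr1 scale1r. Qed.

Lemma deg_binomS p n : n.+1%:R * B p n.+1 = (p - (n%:R * lam)%:P) * B p n.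
Proof.
rewrite /deg_binom /deg_ffact big_ord_recr /= mulrC [in RHS]mulrC.
rewrite -!scalerAl -mulrA [_ * n.+1%:R]mulrC mulrA scalerAl.
rewrite [in LHS]mulr_natr -scaler_nat !scalerA scalerAl factS natrM.
by rewrite invfM [_^-1 * _^-1]mulrC divfK ?pnatr_eq0.
Qed.

(** In characteristic 0 the factor [n.+1%:R] cancels in [{poly R}], so each coefficient is
    determined by the previous one. *)
Lemma deg_binom_uniq p (f : fps {poly R}) : f 0%N = 1 ->
    (forall n, n.+1%:R * f n.+1 = (p - (n%:R * lam)%:P) * f n) -> f = B p.
Proof.
move=> f0 fS; apply/funext; elim=> [|n IHn]; first by rewrite f0 deg_binom0.
have nz : n.+1%:R != 0 :> {poly R} by rewrite -polyC_natr polyC_eq0 pnatr_eq0.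
by apply: (mulfI nz); rewrite fS IHn deg_binomS.
Qed.

(* The recurrence of [deg_binom_uniq] is the differential equation
   (1 + lam t) f' = p f; the product satisfies it by the Leibniz rule. *)
Lemma deg_binom_vandermonde p q : fps_mul (B p) (B q) = B (p + q).
Proof.
apply: deg_binom_uniq => [|n].
  by rewrite /fps_mul big_ord1 !deg_binom0 mulr1.
have split_weight (i : 'I_n.+2) :
    n.+1%:R * (B p i * B q (n.+1 - i)%N) =
    i%:R * B p i * B q (n.+1 - i)%N +
    B p i * ((n.+1 - i)%:R * B q (n.+1 - i)%N).
  have -> : n.+1%:R = i%:R + (n.+1 - i)%:R :> {poly R}.
    by rewrite -natrD subnKC // leq_ord.
  ring.
rewrite /fps_mul !mulr_sumr (eq_bigr _ (fun i _ => split_weight i)) big_split /=.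
(* The end terms dropped here have weight 0: i = 0 in the first sum, i = n + 1 in the second. Both
   sums then run over ['I_n.+1]. *)
rewrite big_ord_recl [X in _ + X]big_ord_recr /= subnn !mul0r mulr0 add0r addr0.
rewrite -big_split /=; apply: eq_bigr => i _.
have le_in : (i <= n)%N := leq_ord i.
rewrite /bump add1n subSS subSn // !deg_binomS.
have -> : n%:R * lam = i%:R * lam + (n - i)%:R * lam.
  by rewrite -mulrDl -natrD subnKC.
rewrite polyCD; ring.
Qed.

Lemma fps_binomialE p : lam != 0 -> fps_binomial lam (lam^-1 *: p) = B p.
Proof.
move=> lam0; apply/funext => n.
rewrite /fps_binomial /deg_binom /deg_ffact mulrC -scalerA; congr (_ *: _).
(* Reading the exponent as the number of factors gives each factor one [lam]. *)
rewrite -[n in lam ^+ n]card_ord -scaler_prodl.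
apply: eq_bigr => i _.
by rewrite scalerBr scalerA divff // scale1r polyCM mulrC mul_polyC polyC_natr.
Qed.

Lemma deg_binom_difference k p n :
  \sum_(l < k.+1) 'C(k, l)%:R * (-1) ^+ (k - l) * B (l%:R + p) n =
  fps_mul (B p) (fps_exp (fps_sub (B 1) (fps_one {poly R})) k) n.
Proof.
elim: k p => [|k IHk] p.
  by rewrite big_ord1 mul1r mul1r add0r /= fps_mul1.
rewrite (binomial_differenceS _ (fun l => B (l%:R + p) n)).
(* The shift of l is moved into the base point, so the induction hypothesis applies at [1 + p] and
   at [p]. *)
under eq_bigr => l _ do rewrite -natr1 -addrA.
rewrite !IHk /= fps_mulA fps_mulBr fps_mul1 deg_binom_vandermonde fps_mulBl.
by rewrite [p + 1]addrC.
Qed.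

End DegenerateBinomial.

Theorem theorem1 (R : realType) (lam : R) (hlam : lam != 0) (n k : nat) :
  (n`!%:R / k`!%:R) *:
    \sum_(l < k.+1)
      'C(k, l)%:R * (-1) ^+ (k - l) * deg_binom lam (l%:R + 'X) n
  = if (k <= n)%N then deg_stirling2 lam n k else 0.
Proof.
rewrite deg_binom_difference; case: leqP => [_ | lt_nk].
  rewrite /deg_stirling2 /deg_stirling2_gf /fps_scale -scalerA.
  (* This exponent is the case [p = 1] of [fps_binomialE]. *)
  have -> : (lam^-1)%:P = lam^-1 *: 1 :> {poly R} by rewrite alg_polyC.
  by rewrite !fps_binomialE.
rewrite (fps_mul_vanish 0 k) ?scaler0 // => j.
by apply: fps_exp_vanish; rewrite /fps_sub deg_binom0 subrr.
Qed.
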